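(* Let $\mathbb{F}$ be a finite field of characteristic $2$, and let $A=(a_{ij})$, $B=(b_{ij})\in M_2(\mathbb{F}[x])$ be matrices with $b_{11}+b_{22}\ne0$ that are conjugate by an element of $\mathrm{GL}(2,\mathbb{F}[x])$. Suppose we are in the imaginary case, i.e. the equation $t^2+(b_{11}+b_{22})t+b_{12}b_{21}=0$ has no solution in $K$. Then $$r_{A,B}\le 2\delta,$$ where $\delta$ is the maximum of $\deg(A)$ and $\deg(B)$.
   Context: $K=\{\sum_{i=-\infty}^{d}\alpha_i x^i : \alpha_i\in\mathbb{F},\ d\in\mathbb{Z}\}$ is the field of formal Laurent series in $x^{-1}$ over $\mathbb{F}$ (the completion of $\mathbb{F}(x)$ at infinity). For a matrix over $\mathbb{F}[x]$, $\deg$ denotes the maximal degree of its entries. $r_{A,B}=\min\{\deg U : U\in \mathrm{GL}(2,\mathbb{F}[x]),\ UAU^{-1}=B\}$. Matrix $A$ being conjugate to $B$ reduces to the quadratic equation $b_{21}u^2+(b_{11}+b_{22})uv+b_{12}v^2=a_{21}$, which after multiplication by $b_{21}$ takes the form $u_1^2+bu_1v_1+cv_1^2=d$ with $b=b_{11}+b_{22}$, $c=b_{12}b_{21}$, $d=a_{21}b_{21}$; the imaginary case is that $t^2+bt+c=0$ has no root in $K$. *)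

(* Defs.v *)
From HB Require Import structures.
From mathcomp Require Import all_boot all_order all_algebra zify.
From mathcomp Require Import boolp classical_sets functions cardinality fsbigop.

Set Implicit Arguments.
Unset Strict Implicit.
Unset Printing Implicit Defensive.

Import Order.TTheory GRing.Theory Num.Theory.
Local Open Scope ring_scope.

Section LaurentSeries.
Variable F : fieldType.
Implicit Types (f g h : int -> F) (d e : int) (P Q : {poly F}).

Definition bounded_by d f := forall i, d < i -> f i = 0.

Definition laurent_pred : {pred int -> F} :=
  fun f => `[< exists d, bounded_by d f >].

(* The series \sum_(i <= d) f i x^i in the powers of x^-1 is represented by    *)
(* its coefficient function f, which vanishes above some integer.              *)
Record laurent : Type := Laurent {
  lcoef :> int -> F;
  lcoefP : lcoef \in laurent_pred }.

HB.instance Definition _ := [isSub for lcoef].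
HB.instance Definition _ := [Choice of laurent by <:].

Fact laurent_zmod_closed : zmod_closed laurent_pred.
Proof.
split; first by apply/asboolP; exists 0.
move=> f g /asboolP[d fd] /asboolP[e ge]; apply/asboolP; exists (Num.max d e).
move=> i; rewrite gt_max => /andP[di ei].
by change (f i - g i = 0); rewrite fd // ge // subr0.
Qed.

HB.instance Definition _ :=
  GRing.isZmodClosed.Build (int -> F) laurent_pred laurent_zmod_closed.
HB.instance Definition _ := [SubChoice_isSubZmodule of laurent by <:].

(* Cauchy product; if f and g vanish above some integer, then the sum has      *)
(* finite support, and so is not the default value 0 of an infinite sum.       *)
Definition cauchy f g : int -> F :=
  fun n => \sum_(i \in [set: int]%classic) f i * g (n - i).

(* approx d f n P: f vanishes above d, and the n + 1 leading coefficients of   *)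
(* x^-d f as a series in x^-1 are those of P.                                  *)
Definition approx d f (n : nat) P :=
  bounded_by d f /\ forall k : nat, (k <= n)%N -> P`_k = f (d - k%:Z).

Lemma approx_ex d f n : bounded_by d f ->
  approx d f n (\poly_(k < n.+1) f (d - k%:Z)).
Proof. by move=> fd; split=> // k kn; rewrite coef_poly ltnS kn. Qed.

Lemma approx_inj d f g : (forall n, exists2 P, approx d f n P & approx d g n P) ->
  f = g.
Proof.
move=> fg; apply/funext => i; case: (ltP d i) => [di|id].
  by have [P [fd _] [gd _]] := fg 0%N; rewrite fd ?gd.
have [P [_ Pf] [_ Pg]] := fg `|d - i|%N.
have := Pf _ (leqnn _); rewrite Pg // => E.
by have -> : i = d - `|d - i|%N%:Z by lia.
Qed.

Lemma cauchy_bounded d e f g : bounded_by d f -> bounded_by e g ->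
  bounded_by (d + e) (cauchy f g).
Proof.
move=> fd ge n den; apply: fsbig1 => i _.
case: (ltP d i) => [di|id]; first by rewrite fd ?mul0r.
by rewrite ge ?mulr0 //; lia.
Qed.

Lemma cauchyE d e f g (n : nat) : bounded_by d f -> bounded_by e g ->
  cauchy f g (d + e - n%:Z) =
  \sum_(k < n.+1) f (d - k%:Z) * g (e - (n - k)%:Z).
Proof.
move=> fd ge.
rewrite /cauchy -(big_mkord xpredT (fun k => f (d - k%:Z) * g (e - (n - k)%:Z))).
rewrite (@fsbigE _ _ _ _ _ [seq d - k%:Z | k <- index_iota 0 n.+1]) //.
- rewrite (eq_bigl xpredT); last by move=> i; rewrite in_setT.
  rewrite big_map; apply: eq_big_nat => k /andP[_ kn].
  by congr (_ * g _); lia.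
- by rewrite map_inj_uniq ?iota_uniq // => i j; lia.
- move=> i _; apply: contraNeq => fg0; apply/mapP; exists `|d - i|%N.
    have id : i <= d.
      by case: (ltP d i) fg0 => // /fd ->; rewrite mul0r eqxx.
    have ni : d - i <= n%:Z.
      case: (leP (d - i) n%:Z) fg0 => // din.
      by rewrite (ge (d + e - n%:Z - i)) ?mulr0 ?eqxx //; lia.
    by rewrite mem_index_iota; lia.
  by case: (ltP d i) fg0 => [/fd ->|id _]; [rewrite mul0r eqxx|lia].
Qed.

Lemma approx_mul d e f g n P Q : approx d f n P -> approx e g n Q ->
  approx (d + e) (cauchy f g) n (P * Q).
Proof.
move=> [fd Pf] [ge Qg]; split; first exact: cauchy_bounded.
move=> k kn; rewrite (cauchyE _ fd ge) coefM; apply: eq_bigr => i _.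
by have := ltn_ord i; rewrite ltnS => ik; rewrite Pf ?Qg //; lia.
Qed.

Lemma approx_add d f g n P Q : approx d f n P -> approx d g n Q ->
  approx d (f + g) n (P + Q).
Proof.
move=> [fd Pf] [gd Qg]; split.
  by move=> i di; change (f i + g i = 0); rewrite fd ?gd ?addr0.
by move=> k kn; rewrite coefD Pf ?Qg.
Qed.

Definition lone : int -> F := fun i => (i == 0)%:R.

Lemma approx_one n : approx 0 lone n 1.
Proof.
split=> [i i0|k _]; first by rewrite /lone gt_eqF.
by rewrite /lone coef1 sub0r oppr_eq0.
Qed.

Fact cauchy_subproof (u v : laurent) : cauchy u v \in laurent_pred.
Proof.
case: u v => [f fP] [g gP] /=; case/asboolP: fP => d fd; case/asboolP: gP => e ge.
by apply/asboolP; exists (d + e); exact: cauchy_bounded.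
Qed.

Fact lone_subproof : lone \in laurent_pred.
Proof. by apply/asboolP; exists 0; case: (approx_one 0). Qed.

Definition laurent_mul (u v : laurent) := Laurent (cauchy_subproof u v).
Definition laurent_one := Laurent lone_subproof.

Lemma laurent_bound (u : laurent) : exists d, bounded_by d u.
Proof. exact: asboolW (lcoefP u). Qed.

Fact laurent_mulA : associative laurent_mul.
Proof.
move=> u v w; apply: val_inj => /=.
have [d ud] := laurent_bound u; have [e ve] := laurent_bound v.
have [b wb] := laurent_bound w; apply: (@approx_inj (d + (e + b))) => n.
have [uP vQ wR] := And3 (approx_ex n ud) (approx_ex n ve) (approx_ex n wb).
eexists; first exact: approx_mul uP (approx_mul vQ wR).
by rewrite mulrA addrA; apply: approx_mul (approx_mul uP vQ) wR.
Qed.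

Fact laurent_mulC : commutative laurent_mul.
Proof.
move=> u v; apply: val_inj => /=.
have [d ud] := laurent_bound u; have [e ve] := laurent_bound v.
apply: (@approx_inj (d + e)) => n.
have [uP vQ] := conj (approx_ex n ud) (approx_ex n ve).
eexists; first exact: approx_mul uP vQ.
by rewrite mulrC addrC; apply: approx_mul vQ uP.
Qed.

Fact laurent_mul1 : left_id laurent_one laurent_mul.
Proof.
move=> u; apply: val_inj => /=; have [d ud] := laurent_bound u.
apply: (@approx_inj d) => n; have uP := approx_ex n ud; eexists; last exact: uP.
by have := approx_mul (approx_one n) uP; rewrite add0r mul1r.
Qed.

Lemma bounded_le d e f : d <= e -> bounded_by d f -> bounded_by e f.
Proof. by move=> de fd i ei; apply: fd; exact: le_lt_trans ei. Qed.

Fact laurent_mulDl : left_distributive laurent_mul +%R.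
Proof.
move=> u v w; apply: val_inj.
have [d0 ud] := laurent_bound u; have [e0 ve] := laurent_bound v.
have [b wb] := laurent_bound w; pose d := Num.max d0 e0.
have {}ud : bounded_by d u by apply: bounded_le ud; rewrite le_max lexx.
have {}ve : bounded_by d v by apply: bounded_le ve; rewrite le_max lexx orbT.
apply: (@approx_inj (d + b)) => n.
have [uP vQ wR] := And3 (approx_ex n ud) (approx_ex n ve) (approx_ex n wb).
eexists; first exact: approx_mul (approx_add uP vQ) wR.
by rewrite mulrDl; apply: approx_add; exact: approx_mul.
Qed.

Fact laurent_one_neq0 : laurent_one != 0.
Proof.
apply/eqP => /(congr1 (fun u : laurent => u 0)) /=.
by rewrite /lone eqxx => /eqP; rewrite oner_eq0.
Qed.

HB.instance Definition _ := GRing.Zmodule_isComNzRing.Build laurent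
  laurent_mulA laurent_mulC laurent_mul1 laurent_mulDl laurent_one_neq0.

Definition laurent_inv (u : laurent) : laurent :=
  xget 0 [set v : laurent | v * u = 1]%classic.

Lemma laurent_lead (u : laurent) : u != 0 ->
  exists2 d, bounded_by d u & u d != 0.
Proof.
move=> u0; have [d ud] := laurent_bound u.
have /existsNP[i /eqP ui] : ~ forall i, u i = 0.
  by move=> H; case/eqP: u0; apply: val_inj; apply/funext => i; exact: H.
have id : i <= d by case: (ltP d i) ui => // /ud ->; rewrite eqxx.
have ex : exists k : nat, u (d - k%:Z) != 0.
  by exists `|d - i|%N; have <- : i = d - `|d - i|%N%:Z by lia.
exists (d - (ex_minn ex)%:Z); case: ex_minnP => k uk kmin // j kj.
apply/eqP/negPn/negP => uj; have [dj|jd] := ltP d j.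
  by rewrite ud ?eqxx in uj.
have := kmin `|d - j|%N; have <- : j = d - `|d - j|%N%:Z by lia.
by move=> /(_ uj); lia.
Qed.

(* Coefficients of the inverse of a power series with constant term != 0.     *)
Fixpoint inv_coefs (a : nat -> F) n : seq F :=
  if n is m.+1 then
    let s := inv_coefs a m in
    rcons s (((m == 0%N)%:R - \sum_(k < m) s`_k * a (m - k)%N) / a 0%N)
  else [::].

Lemma size_inv_coefs a n : size (inv_coefs a n) = n.
Proof. by elim: n => //= n IHn; rewrite size_rcons IHn. Qed.

Lemma nth_inv_coefs a n k : (k < n)%N ->
  (inv_coefs a n)`_k = (inv_coefs a k.+1)`_k.
Proof.
elim: n => // n IHn; rewrite ltnS leq_eqVlt => /orP[/eqP->//|kn].
by rewrite [LHS]nth_rcons size_inv_coefs kn IHn.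
Qed.

Lemma inv_coefsP a n : a 0%N != 0 ->
  \sum_(k < n.+1) (inv_coefs a k.+1)`_k * a (n - k)%N = (n == 0%N)%:R.
Proof.
move=> a0; rewrite big_ord_recr /= subnn nth_rcons size_inv_coefs ltnn eqxx.
rewrite divfK // addrC -[RHS]subr0 -addrA; congr (_ + _); apply/eqP.
rewrite oppr0 addrC subr_eq0; apply/eqP; apply: eq_bigr => k _.
by rewrite (nth_inv_coefs _ (ltn_ord k)).
Qed.

Fact laurent_mulV (u : laurent) : u != 0 -> laurent_inv u * u = 1.
Proof.
move=> /laurent_lead[d ud u0].
pose a (k : nat) := u (d - k%:Z).
pose g (i : int) : F :=
  if i <= - d then (inv_coefs a `|- d - i|.+1)`_`|- d - i| else 0.
have gd : bounded_by (- d) g by move=> i; rewrite /g leNgt => ->.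
have gP : g \in laurent_pred by apply/asboolP; exists (- d).
suff gu : Laurent gP * u = 1.
  exact: (xgetI 0 (gu : [set v : laurent | v * u = 1]%classic (Laurent gP))).
apply: val_inj; apply: (@approx_inj 0) => n /=.
exists 1; last exact: approx_one.
split; first by have := cauchy_bounded gd ud; rewrite addNr.
move=> k _; have := cauchyE k gd ud; rewrite addNr => ->.
have a0 : a 0%N != 0 by rewrite /a subr0.
rewrite coef1 -(inv_coefsP k a0); apply: eq_bigr => i _; congr (_ * _).
rewrite /g; have -> : - d - i%:Z <= - d by lia.
by have -> : `|(- d - (- d - i%:Z))%R|%N = i by lia.
Qed.

Fact laurent_inv0 : laurent_inv 0 = 0.
Proof.
rewrite /laurent_inv; case: xgetP => // v _ /= /eqP.
by rewrite mulr0 eq_sym oner_eq0.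
Qed.

HB.instance Definition _ :=
  GRing.ComNzRing_isField.Build laurent laurent_mulV laurent_inv0.

Definition pcoef P : int -> F := fun i => if i is Posz n then P`_n else 0.

Fact pcoef_subproof P : pcoef P \in laurent_pred.
Proof.
apply/asboolP; exists (size P)%:Z; case=> [n Pn|//].
by rewrite /pcoef nth_default // ltnW.
Qed.

Definition laurent_of_poly P := Laurent (pcoef_subproof P).

Fact laurent_of_poly_zmod : zmod_morphism laurent_of_poly.
Proof.
move=> P Q; apply: val_inj; apply/funext => -[n|n].
  by change ((P - Q)`_n = P`_n - Q`_n); rewrite coefB.
by change (0 = 0 - 0 :> F); rewrite subr0.
Qed.

Fact laurent_of_poly_monoid : monoid_morphism laurent_of_poly.
Proof.
split; first by apply: val_inj; apply/funext => -[n|n] //; exact: coef1.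
move=> P Q; apply: val_inj; apply/funext => n /=.
pose N := maxn (size P) (size Q).
have bd (R : {poly F}) : (size R <= N)%N -> bounded_by N%:Z (pcoef R).
  by move=> RN [m Nm|//]; rewrite /pcoef nth_default // (leq_trans RN) // ltnW.
have bP : bounded_by N%:Z (pcoef P) by apply: bd; rewrite leq_maxl.
have bQ : bounded_by N%:Z (pcoef Q) by apply: bd; rewrite leq_maxr.
rewrite /cauchy; case: n => [n|n] /=; last first.
  rewrite fsbig1 // => -[i|i] _; last by rewrite mul0r.
  by rewrite (_ : Negz n - i%:Z = Negz (n + i)%N) ?mulr0 //; lia.
rewrite coefM -(big_mkord xpredT (fun k => P`_k * Q`_(n - k))).
rewrite (@fsbigE _ _ _ _ _ [seq Posz k | k <- index_iota 0 n.+1]) //.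
- rewrite [RHS](eq_bigl xpredT); last by move=> i; rewrite in_setT.
  rewrite big_map; apply: eq_big_nat => k /andP[_ kn].
  by rewrite (_ : n%:Z - k%:Z = (n - k)%N) //; lia.
- by rewrite map_inj_uniq ?iota_uniq // => i j [].
- move=> [i|i] _; last by rewrite mul0r.
  apply: contraNeq => PQ; apply/mapP; exists i => //; rewrite mem_index_iota /=.
  case: (leqP i n) PQ => // ni.
  by rewrite (_ : n%:Z - i%:Z = Negz (i - n)%N.-1) ?mulr0 ?eqxx //; lia.
Qed.

HB.instance Definition _ := GRing.isZmodMorphism.Build
  {poly F} laurent laurent_of_poly laurent_of_poly_zmod.
HB.instance Definition _ := GRing.isMonoidMorphism.Build
  {poly F} laurent laurent_of_poly laurent_of_poly_monoid.

End LaurentSeries.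

Section Conjugation.
Variable F : fieldType.
Implicit Types A B U : 'M[{poly F}]_2.

(* The maximal degree of the entries; zero entries count as degree 0, which    *)
(* changes the value only for the zero matrix.                                 *)
Definition mxdeg A : nat := \max_(i < 2) \max_(j < 2) (size (A i j)).-1.

Definition conjugates U A B := U \in unitmx /\ U *m A *m invmx U = B.

Definition conjugate A B := exists U, conjugates U A B.

Fact conj_deg_subproof A B : conjugate A B ->
  exists n, `[< exists2 U, conjugates U A B & mxdeg U = n >].
Proof. by move=> [U UAB]; exists (mxdeg U); apply/asboolP; exists U. Qed.

(* r_{A,B}, defined for conjugate A and B, where the minimum exists.           *)
Definition conj_deg A B (AB : conjugate A B) : nat :=
  ex_minn (conj_deg_subproof AB).

End Conjugation.

(* Main.v *)
Require Import Defs.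
From mathcomp Require Import all_boot all_order all_algebra ring zify.
From mathcomp Require Import boolp.
Import Order.TTheory GRing.Theory Num.Theory.
Local Open Scope ring_scope.

(** In fact every matrix U conjugating A to B has degree at most 2 delta.

    Write UA = BU.  In characteristic 2 each column (u, v) of U satisfies
    b21 u^2 + (b11 + b22) u v + b12 v^2 = det U * a, where a is an off-diagonal
    entry of A [conj_column_norm]; the determinant of U is a nonzero constant.
    Multiplying by b21 makes this u1^2 + b u1 v + c v^2 = d with u1 = b21 u,
    b = b11 + b22, c = b12 b21, and both c and d have degree at most 2 delta.

    The left-hand side is the norm of u1 + v theta for a root theta of
    t^2 + b t + c.  As there is no root in K, the form is anisotropic over the
    complete field K, so the degree of a value controls the degrees of u1 and v
    [anisotropic_norm_bound].  Explicitly: replacing theta by theta + w for a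
    polynomial w changes c into w^2 + b w + c, and since F is perfect one can
    cancel the leading term of c as long as deg c is even and exceeds 2 deg b.
    When this stops, either deg c is odd and greater than 2 deg b, so u^2 and
    c v^2 have degrees of different parity and nothing cancels at the top; or
    deg c = 2 deg b and the top coefficient of a value is a value of the form
    over F made of the leading coefficients, which has no nontrivial zero; or
    else t^2 + b t + c has a root in K.  The last alternative is where
    completeness enters: with t = b s the equation is of Artin-Schreier type
    s^2 + s = e with e of degree at most 0, and it is solvable as soon as its
    reduction to constant terms is [artin_schreier]. *)

(** * Squares of Laurent series in characteristic 2 *)

Lemma pchar2_poly {F : fieldType} :
  2%N \in [pchar F] -> 2%N \in [pchar {poly F}].
Proof. by move=> ?; apply: (rmorph_pchar (@polyC F)). Qed.

Lemma pchar2_laurent {F : fieldType} :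
  2%N \in [pchar F] -> 2%N \in [pchar laurent F].
Proof.
by move=> charF2; apply: (rmorph_pchar (@laurent_of_poly F)); exact: pchar2_poly.
Qed.

Lemma coef_sqr_pchar2 {F : fieldType} (P : {poly F}) (m : nat) :
  2%N \in [pchar F] -> (P ^+ 2)`_m = if odd m then 0 else P`_m./2 ^+ 2.
Proof.
move=> charF2; elim/poly_ind: P m => [|P c IHP] m.
  by rewrite expr0n !coef0 expr0n /= if_same.
have -> : (P * 'X + c%:P) ^+ 2 = P ^+ 2 * 'X^2 + (c ^+ 2)%:P.
  rewrite sqrrD -mulr_natr (pcharf0 (pchar2_poly charF2)) mulr0 addr0 exprMn.
  by rewrite rmorphXn.
rewrite coefD coefMXn coefC; case: m => [|[|m]] /=.
- by rewrite coefD coefMX coefC add0r /= add0r.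
- by rewrite addr0.
- by rewrite subSS subn1 /= IHP negbK coefD coefMX coefC !addr0.
Qed.

Lemma coef_laurent_sqr_pchar2 {F : fieldType} (s : laurent F) (m : nat) :
  2%N \in [pchar F] -> bounded_by 0 s ->
  (s ^+ 2) (- m%:Z) = if odd m then 0 else s (- m./2%:Z) ^+ 2.
Proof.
move=> charF2 s0; have sP := approx_ex m s0.
have [_ /(_ m (leqnn m))] := approx_mul sP sP.
have -> : (s ^+ 2) (- m%:Z) = cauchy s s (- m%:Z) by [].
rewrite -expr2 coef_sqr_pchar2 // addr0 add0r => <-; case: ifP => // _.
by rewrite coef_poly sub0r ltnS; case: leqP => //; lia.
Qed.

(** The coefficient of x^-m in a solution s of s^2 + s = e with constant term
    s0, where e m is the coefficient of x^-m in e.  The recursion passes from m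
    to m / 2, and n is fuel for it. *)
Fixpoint as_coef {F : fieldType} (e : nat -> F) (s0 : F) (n m : nat) : F :=
  if n is n'.+1 then
    if m is 0 then s0 else
    e m - (if odd m then 0 else as_coef e s0 n' m./2 ^+ 2)
  else s0.

Lemma as_coef_stable {F : fieldType} (e : nat -> F) (s0 : F) (n m : nat) :
  (m <= n)%N -> as_coef e s0 n m = as_coef e s0 m m.
Proof.
have [k] := ubnP m; elim: k m n => // k IHk [|m] [|n] // mk mn.
rewrite [LHS]/= [RHS]/=; case: ifP => // _.
by rewrite uphalfE (IHk _ n) ?(IHk _ m) //; lia.
Qed.

(** Squaring sends the coefficient of x^-m to that of x^-2m, so s^2 + s = e
    determines the coefficients of s one after the other from the constant
    term; this replaces an appeal to Hensel's lemma. *)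
Lemma artin_schreier {F : fieldType} (e : laurent F) (s0 : F) :
  2%N \in [pchar F] -> bounded_by 0 e -> e 0 = s0 ^+ 2 + s0 ->
  exists s : laurent F, s ^+ 2 + s = e.
Proof.
move=> charF2 e_le0 e0.
pose a m := as_coef (fun m => e (- m%:Z)) s0 m m.
pose f (i : int) : F := if i <= 0 then a `|i|%N else 0.
have f_le0 : bounded_by 0 f by move=> i; rewrite /f ltNge; case: ifP.
have fP : f \in @laurent_pred F by apply/asboolP; exists 0.
pose s := Laurent fP.
have sE m : s (- m%:Z) = a m.
  by rewrite /= /f oppr_le0 /= abszN.
exists s; apply: val_inj; apply/funext => i.
have -> : val (s ^+ 2 + s) i = (s ^+ 2) i + s i by [].
have [i_gt0|i_le0] := ltP 0 i.
  have -> : (s ^+ 2) i = 0 by apply: (cauchy_bounded f_le0 f_le0).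
  by rewrite [s i]f_le0 // addr0 [RHS]e_le0.
have -> : i = - `|i|%N%:Z by lia.
rewrite coef_laurent_sqr_pchar2 // !sE; case: `|i|%N => [|m] /=.
  by rewrite oppr0 e0.
rewrite {2}/a /=; case: ifP => _; first by rewrite add0r subr0.
rewrite (as_coef_stable (fun m => e (- m%:Z)) s0 m (uphalf m)).
  by rewrite addrC subrK.
by rewrite uphalfE; lia.
Qed.

(** * Roots of quadratic polynomials in the field of Laurent series *)

Lemma laurent_of_poly_bounded {F : fieldType} (P : {poly F}) :
  bounded_by (size P).-1%:Z (laurent_of_poly P).
Proof. by case=> [i|i] //= Pi; apply: nth_default; lia. Qed.

Lemma cauchy_top {F : fieldType} (d e : int) (f g : int -> F) :
  bounded_by d f -> bounded_by e g -> cauchy f g (d + e) = f d * g e.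
Proof.
move=> fd ge; have := cauchyE 0 fd ge.
by rewrite subr0 big_ord1 /= subn0 !subr0.
Qed.

(** The degree of a product is the sum of the degrees, so a quotient of two
    series of degree at most d, with denominator of degree exactly d, has degree
    at most 0. *)
Lemma bounded_by_factor {F : fieldType} (d : int) (u v : laurent F) :
  bounded_by d v -> v d != 0 -> bounded_by d (u * v : laurent F) ->
  bounded_by 0 u.
Proof.
move=> vd vd0 uvd; have [->//|u0] := eqVneq u 0.
have [k uk uk0] := laurent_lead u0.
apply: bounded_le (uk); rewrite leNgt; apply/negP => k_gt0.
have /eqP : (u * v) (k + d) = 0 by apply: uvd; lia.
by rewrite [_ (k + d)](cauchy_top _ _ _ _ uk vd) mulf_eq0 (negPf uk0)
  (negPf vd0).
Qed.

(** The substitution t = b s turns the equation into s^2 + s = c / b^2.  The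
    coefficient of c in degree 2 deg b may vanish, and then s0 = 0 qualifies. *)
Lemma laurent_root {F : fieldType} (b c : {poly F}) (s0 : F) :
  2%N \in [pchar F] -> b != 0 ->
  ((size c).-1 <= 2 * (size b).-1)%N ->
  c`_(2 * (size b).-1) = lead_coef b ^+ 2 * (s0 ^+ 2 + s0) ->
  exists t : laurent F,
    t ^+ 2 + laurent_of_poly b * t + laurent_of_poly c = 0.
Proof.
move=> charF2 b0 cb ctop; set beta := laurent_of_poly b.
have charL2 := pchar2_laurent charF2.
pose d : int := (2 * (size b).-1)%N.
have b2E : (beta ^+ 2) = laurent_of_poly (b ^+ 2) by rewrite rmorphXn.
have b2d : bounded_by d (beta ^+ 2).
  by rewrite b2E /d mulnC -size_exp; exact: laurent_of_poly_bounded.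
have b2top : (beta ^+ 2) d = lead_coef b ^+ 2.
  by rewrite b2E /d mulnC -size_exp /= -[LHS]lead_coefE lead_coef_exp.
have lb0 : lead_coef b ^+ 2 != 0 by rewrite expf_eq0 lead_coef_eq0.
have beta0 : beta ^+ 2 != 0.
  by apply: contraNneq lb0 => E; rewrite -b2top E.
have [e eb] : exists e, e * beta ^+ 2 = laurent_of_poly c.
  by exists (laurent_of_poly c / beta ^+ 2); rewrite divfK.
have e_le0 : bounded_by 0 e.
  apply: (@bounded_by_factor _ d _ (beta ^+ 2)); rewrite ?b2top // eb.
  by apply: bounded_le (laurent_of_poly_bounded c); rewrite /d; lia.
have e0 : e 0 = s0 ^+ 2 + s0.
  apply: (mulIf lb0); rewrite -[in LHS]b2top.
  have <- := cauchy_top _ _ _ _ e_le0 b2d; rewrite add0r.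
  have -> : cauchy e (beta ^+ 2) d = laurent_of_poly c d by rewrite -eb.
  by rewrite [LHS]ctop mulrC.
have [s se] := artin_schreier e s0 charF2 e_le0 e0.
exists (beta * s); rewrite -eb -se.
have -> : (beta * s) ^+ 2 + beta * (beta * s) + (s ^+ 2 + s) * beta ^+ 2
    = ((beta * s) ^+ 2 + beta ^+ 2 * s) + ((beta * s) ^+ 2 + beta ^+ 2 * s).
  by ring.
exact: addrr_pchar2.
Qed.

(** * Degrees of the values of an anisotropic form *)

Lemma size_mul_pred {F : fieldType} (P Q : {poly F}) : P != 0 -> Q != 0 ->
  size (P * Q) = ((size P).-1 + (size Q).-1).+1.
Proof.
by move=> P0 Q0; rewrite size_mul // (polySpred P0) (polySpred Q0) addnS.
Qed.

(** The terms u^2 and c v^2 have degrees 2 deg u and deg c + 2 deg v, and as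
    2 deg b <= deg c the degree of b u v is at most the mean of these two.  If
    they differ, the larger one is the degree of N.  If they agree, deg c is even,
    so all three terms have the same degree, and the coefficient of N there is
    nonzero because the form built from the leading coefficients has no
    nontrivial zero. *)
Lemma reduced_norm_bound {F : fieldType} (b c u v : {poly F}) :
  b != 0 -> c != 0 -> (2 * (size b).-1 <= (size c).-1)%N ->
  (~~ odd (size c).-1 -> (size c).-1 = (2 * (size b).-1)%N) ->
  ((size c).-1 = (2 * (size b).-1)%N ->
    forall s : F, lead_coef c + lead_coef b ^+ 2 * (s ^+ 2 + s) != 0) ->
  let N := u ^+ 2 + b * u * v + c * v ^+ 2 in
  (2 * size u <= size N + 1)%N /\ (2 * size v <= size N + 1)%N.
Proof.
move=> b0 c0 bc even_c aniso N.
have szS (P : {poly F}) : P != 0 -> size P = (size P).-1.+1 by exact: polySpred.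
have sq (P : {poly F}) : P != 0 -> size (P ^+ 2) = (2 * (size P).-1).+1.
  by move=> P0; rewrite szS ?expf_neq0 // size_exp mulnC.
have [bE cE] := (szS _ b0, szS _ c0).
have [u0|u0] := eqVneq u 0; have [v0|v0] := eqVneq v 0.
- by rewrite u0 v0 size_poly0.
- rewrite /N u0 expr0n mulr0 mul0r !add0r size_poly0.
  rewrite size_mul_pred ?expf_neq0 // sq //.
  by have := szS _ v0; lia.
- rewrite /N v0 expr0n !mulr0 !addr0 size_poly0.
  by rewrite sq //; have := szS _ u0; lia.
have [uE vE] := (szS _ u0, szS _ v0); have [u2E v2E] := (sq _ u0, sq _ v0).
have cvE : size (c * v ^+ 2) = ((size c).-1 + 2 * (size v).-1).+1.
  by rewrite size_mul_pred ?expf_neq0 // v2E.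
have buvE : size (b * u * v) = ((size b).-1 + (size u).-1 + (size v).-1).+1.
  by rewrite size_mul_pred ?mulf_neq0 // size_mul_pred.
have [lt_uv|lt_vu|eq_uv] :=
  ltngtP (2 * (size u).-1)%N ((size c).-1 + 2 * (size v).-1)%N.
- have -> : size N = size (c * v ^+ 2); last by lia.
  rewrite /N addrC size_polyDl // (leq_ltn_trans (size_polyD _ _)) //.
  by rewrite gtn_max u2E buvE cvE; lia.
- have -> : size N = size (u ^+ 2); last by lia.
  rewrite /N -addrA size_polyDl // (leq_ltn_trans (size_polyD _ _)) //.
  by rewrite gtn_max u2E buvE cvE; lia.
have cb : (size c).-1 = (2 * (size b).-1)%N by lia.
suff: (2 * (size u).-1 < size N)%N by lia.
rewrite ltnNge; apply/negP => /(nth_default 0)/eqP; apply/negP.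
have lu : (u ^+ 2)`_(2 * (size u).-1) = lead_coef u ^+ 2.
  by rewrite -lead_coef_exp lead_coefE u2E.
have lbuv : (b * u * v)`_(2 * (size u).-1) =
    lead_coef b * lead_coef u * lead_coef v.
  by rewrite -!lead_coefM lead_coefE buvE; congr (_`_ _); lia.
have lcv : (c * v ^+ 2)`_(2 * (size u).-1) =
    lead_coef c * lead_coef v ^+ 2.
  by rewrite -lead_coef_exp -lead_coefM lead_coefE cvE; congr (_`_ _); lia.
have {b0}lb : lead_coef b != 0 by rewrite lead_coef_eq0.
have {v0}lv : lead_coef v != 0 by rewrite lead_coef_eq0.
rewrite !coefD lu lbuv lcv.
set s := lead_coef u / (lead_coef b * lead_coef v).
(* With s = u / (b v) the form over F becomes v^2 (c + b^2 (s^2 + s)). *)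
have -> : lead_coef u ^+ 2 + lead_coef b * lead_coef u * lead_coef v
    + lead_coef c * lead_coef v ^+ 2
    = lead_coef v ^+ 2 * (lead_coef c + lead_coef b ^+ 2 * (s ^+ 2 + s)).
  by rewrite /s; field; rewrite lb lv.
by rewrite mulf_neq0 ?expf_neq0 // aniso.
Qed.

(** The shift w is an approximate root of t^2 + b t + c, built term by term:
    as long as deg c is even and exceeds 2 deg b, the leading term of c is the
    square of a monomial w0 and w0^2 + b w0 + c has smaller degree. *)
Lemma ex_shift_norm_bound {F : fieldType} (b c : {poly F}) :
  2%N \in [pchar F] -> (forall a : F, exists r, r ^+ 2 = a) -> b != 0 ->
  (~ exists t : laurent F,
     t ^+ 2 + laurent_of_poly b * t + laurent_of_poly c = 0) ->
  exists w : {poly F}, (2 * size w <= size c + 1)%N /\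
    forall u v : {poly F},
      let N := u ^+ 2 + b * u * v + (w ^+ 2 + b * w + c) * v ^+ 2 in
      (2 * size u <= size N + 1)%N /\ (2 * size v <= size N + 1)%N.
Proof.
move=> charF2 sqrtF b0; have [n] := ubnP (size c).
elim: n c => // n IHn c ltcn noroot.
have charP2 := pchar2_poly charF2; have charL2 := pchar2_laurent charF2.
have c0 : c != 0.
  by apply: contra_notN noroot => /eqP->; exists 0;
    rewrite rmorph0 expr0n mulr0 !addr0.
have cS := polySpred c0; have bS := polySpred b0.
have root s0 : ((size c).-1 <= 2 * (size b).-1)%N ->
    c`_(2 * (size b).-1) != lead_coef b ^+ 2 * (s0 ^+ 2 + s0).
  by move=> cb; apply: contra_notN noroot => /eqP; exact: laurent_root.
have bc : (2 * (size b).-1 <= (size c).-1)%N.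
  rewrite leqNgt; apply/negP => cb; have /eqP[] := root 0 (ltnW cb).
  by rewrite expr0n addr0 mulr0 nth_default // cS.
have [stop|] := boolP (odd (size c).-1 || ((size c).-1 == 2 * (size b).-1)%N).
  exists 0; split=> [|u v]; first by rewrite size_poly0; lia.
  rewrite expr0n mulr0 !add0r.
  apply: reduced_norm_bound => // [|cb s]; first by case/orP: stop => [->|/eqP].
  rewrite -[lead_coef b ^+ 2 * _]opprK subr_eq0 oppr_pchar2 //.
  by rewrite lead_coefE cb; apply: root; rewrite cb.
rewrite negb_or => /andP[c_even c_neq].
have [h ch] : exists h, (size c).-1 = (2 * h)%N by exists (size c).-1./2; lia.
have [r rc] := sqrtF (lead_coef c).
pose w0 : {poly F} := r *: 'X^h; pose c1 : {poly F} := w0 ^+ 2 + b * w0 + c.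
have w0S : (size w0 <= h.+1)%N.
  by rewrite (leq_trans (size_scale_leq _ _)) ?size_polyXn.
have c1c : (size c1 < size c)%N.
  have -> : c1 = w0 ^+ 2 + c + b * w0 by rewrite /c1 addrAC.
  rewrite cS ltnS (leq_trans (size_polyD _ _)) // geq_max; apply/andP; split.
    apply/leq_sizeP => j; rewrite ch leq_eqVlt => /orP[/eqP <-|hj].
      rewrite coefD exprZn -exprM (mulnC h 2) coefZ coefXn eqxx mulr1 rc.
      by rewrite -ch -lead_coefE addrr_pchar2.
    rewrite coefD exprZn -exprM coefZ coefXn gtn_eqF ?mulr0 ?add0r; last by lia.
    by rewrite nth_default // cS ch.
  by rewrite (leq_trans (size_polyMleq _ _)) //; lia.
have [||w1 [w1S bound]] := IHn c1; first by lia.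
  apply: contra_not noroot => -[t t0].
  exists (t + laurent_of_poly w0).
  rewrite -[RHS]t0 /c1 !(rmorphD (@laurent_of_poly F)) rmorphXn rmorphM.
  rewrite sqrrD mulr2n (addrr_pchar2 charL2) addr0.
  by ring.
exists (w0 + w1); split.
  have wS : (size (w0 + w1)%R <= maxn (size w0) (size w1))%N := size_polyD w0 w1.
  by clear -wS w0S w1S c1c ch cS; lia.
have -> : (w0 + w1) ^+ 2 + b * (w0 + w1) + c = w1 ^+ 2 + b * w1 + c1; last by [].
rewrite sqrrD mulr2n addrr_pchar2 // addr0 /c1.
by ring.
Qed.

(** In terms of the shift w and of u' = u + w v, one has
    d = u'^2 + b u' v + (w^2 + b w + c) v^2, so the bounds on u' and v apply, and
    the degree of u = u' - w v is at most the larger of those of u' and w v. *)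
Lemma anisotropic_norm_bound {F : fieldType} (b c u v : {poly F}) :
  2%N \in [pchar F] -> (forall a : F, exists r, r ^+ 2 = a) -> b != 0 ->
  (~ exists t : laurent F,
     t ^+ 2 + laurent_of_poly b * t + laurent_of_poly c = 0) ->
  let d := u ^+ 2 + b * u * v + c * v ^+ 2 in
  (2 * size u <= size c + size d + 1)%N /\ (2 * size v <= size d + 1)%N.
Proof.
move=> charF2 sqrtF b0 noroot d.
have charP2 := pchar2_poly charF2.
have [w [wS bound]] := ex_shift_norm_bound b c charF2 sqrtF b0 noroot.
have := bound (u + w * v) v.
rewrite (_ : _ + _ + _ = d); last first.
  rewrite -[RHS]addr0 -(addrr_pchar2 charP2
    (w ^+ 2 * v ^+ 2 + b * w * v ^+ 2 + u * w * v)).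
  rewrite /d; ring.
move=> [uS vS]; split=> //.
have wvS : (size (w * v)%R <= (size w + size v).-1)%N := size_polyMleq w v.
have uE : u = (u + w * v) - w * v by rewrite addrK.
have uwvS : (size u <= maxn (size (u + w * v)%R) (size (w * v)%R))%N.
  by rewrite -(size_polyN (w * v)) {1}uE; exact: size_polyD.
have [v0|v0] := eqVneq v 0.
  by move: uS; rewrite v0 mulr0 addr0; lia.
by have vS' : size v = (size v).-1.+1 := polySpred v0; lia.
Qed.

(** * Conjugating matrices *)

Lemma sqrt_pchar2 {F : finFieldType} (a : F) :
  2%N \in [pchar F] -> exists r, r ^+ 2 = a.
Proof.
move=> charF2; have sqr_inj : injective (fun r : F => r ^+ 2).
  move=> x y /= /eqP; rewrite -subr_eq0 subr_sqr mulf_eq0.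
  by rewrite -{2}(oppr_pchar2 charF2 y) orbb subr_eq0 => /eqP.
by exists (invF sqr_inj a); exact: (f_invF sqr_inj).
Qed.

Lemma size_mxdeg {F : fieldType} (A : 'M[{poly F}]_2) (i j : 'I_2) :
  (size (A i j) <= (mxdeg A).+1)%N.
Proof.
apply: (leq_trans (leqSpred _)); rewrite ltnS.
apply: leq_trans (leq_bigmax i).
exact: (leq_bigmax (F := fun j => (size (A i j)).-1)).
Qed.

Lemma ord2P (i : 'I_2) : i = 0 \/ i = 1.
Proof. by case: i => -[|[|]] // ?; [left|right]; apply: val_inj. Qed.

(** Read the column j of UA = BU as two scalar equations, and add the first
    multiplied by U 1 j to the second multiplied by U 0 j: one side becomes the
    quadratic form of B, and on the other side the coefficient of A j j is
    twice a product, hence zero. *)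
Lemma conj_column_norm {R : comNzRingType} (U A B : 'M[R]_2) (j : 'I_2) :
  2%N \in [pchar R] -> U *m A = B *m U ->
  B 1 0 * U 0 j ^+ 2 + (B 0 0 + B 1 1) * U 0 j * U 1 j + B 0 1 * U 1 j ^+ 2
  = \det U * A (rev_ord j) j.
Proof.
move=> charR2 UA.
have sum2 (G : 'I_2 -> R) : \sum_k G k = G 0 + G 1.
  by rewrite !big_ord_recl big_ord0 addr0; congr (_ + G _); apply: val_inj.
have det2 : \det U = U 0 0 * U 1 1 - U 0 1 * U 1 0.
  rewrite (expand_det_row _ 0) sum2 /cofactor !det_mx11 !mxE /=.
  have -> : lift 0 0 = 1 :> 'I_2 by apply: val_inj.
  have -> : lift 1 0 = 0 :> 'I_2 by apply: val_inj.
  by ring.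
have row i : U i 0 * A 0 j + U i 1 * A 1 j = B i 0 * U 0 j + B i 1 * U 1 j.
  by move/matrixP/(_ i j): UA; rewrite !mxE !sum2.
have cross : B 1 0 * U 0 j ^+ 2 + (B 0 0 + B 1 1) * U 0 j * U 1 j
    + B 0 1 * U 1 j ^+ 2
  = U 1 j * (U 0 0 * A 0 j + U 0 1 * A 1 j)
    + U 0 j * (U 1 0 * A 0 j + U 1 1 * A 1 j).
  by rewrite !row; ring.
rewrite cross det2; have [->|->] := ord2P j.
  have -> : rev_ord 0 = 1 :> 'I_2 by apply: val_inj.
  transitivity ((U 0 0 * U 1 1 - U 0 1 * U 1 0) * A 1 0
      + (U 1 0 * (U 0 0 * A 0 0 + U 0 1 * A 1 0)
        + U 1 0 * (U 0 0 * A 0 0 + U 0 1 * A 1 0))); first by ring.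
  by rewrite addrr_pchar2 // addr0.
have -> : rev_ord 1 = 0 :> 'I_2 by apply: val_inj.
transitivity ((U 0 0 * U 1 1 - U 0 1 * U 1 0) * A 0 1
    + (U 0 1 * (U 1 0 * A 0 1 + U 1 1 * A 1 1)
      + U 0 1 * (U 1 0 * A 0 1 + U 1 1 * A 1 1))); first by ring.
by rewrite addrr_pchar2 // addr0.
Qed.

Theorem proposition4p2 (F : finFieldType) (charF2 : 2%N \in [pchar F])
    (A B : 'M[{poly F}]_2)
    (trB : B 0 0 + B 1 1 != 0)
    (AB : conjugate A B)
    (imaginary : ~ exists t : laurent F,
       t ^+ 2 + laurent_of_poly (B 0 0 + B 1 1) * t
         + laurent_of_poly (B 0 1 * B 1 0) = 0) :
  (conj_deg AB <= 2 * maxn (mxdeg A) (mxdeg B))%N.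
Proof.
set delta := maxn _ _.
have sizeA i j : (size (A i j) <= delta.+1)%N.
  by rewrite (leq_trans (size_mxdeg _ _ _)) // ltnS leq_maxl.
have sizeB i j : (size (B i j) <= delta.+1)%N.
  by rewrite (leq_trans (size_mxdeg _ _ _)) // ltnS leq_maxr.
(* If b21 vanished, then 0 would be a root of t^2 + b t + b12 b21. *)
have B10 : B 1 0 != 0.
  apply: contra_notN imaginary => /eqP ->.
  by exists 0; rewrite !mulr0 rmorph0 expr0n !addr0.
have [U [Uunit UAB]] := AB.
have UA : U *m A = B *m U by rewrite -UAB mulmxKV.
have detU : size (\det U) = 1%N.
  by move: Uunit; rewrite unitmxE poly_unitE => /andP[/eqP].
have sizeU i j : (size (U i j) <= (2 * delta).+1)%N.
  pose d : {poly F} := B 1 0 * (\det U * A (rev_ord j) j).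
  have [u1S vS] :
      (2 * size (B 1 0 * U 0 j)%R <= size (B 0 1 * B 1 0)%R + size d + 1)%N /\
      (2 * size (U 1%R j) <= size d + 1)%N.
    suff -> : d = (B 1 0 * U 0 j) ^+ 2
        + (B 0 0 + B 1 1) * (B 1 0 * U 0 j) * U 1 j
        + B 0 1 * B 1 0 * U 1 j ^+ 2.
      exact: anisotropic_norm_bound charF2
        (fun a => sqrt_pchar2 a charF2) trB imaginary.
    rewrite /d -(conj_column_norm U A B j (pchar2_poly charF2) UA).
    by ring.
  have mulS (P Q : {poly F}) :
      (size P <= delta.+1)%N -> (size Q <= delta.+1)%N ->
      (size (P * Q)%R <= (2 * delta).+1)%N.
    by move=> PS QS; rewrite (leq_trans (size_polyMleq _ _)) //; lia.
  have dS : (size d <= (2 * delta).+1)%N.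
    by rewrite mulS // (leq_trans (size_polyMleq _ _)) // detU add1n sizeA.
  have cS : (size (B 0 1 * B 1 0)%R <= (2 * delta).+1)%N by exact: mulS.
  have uS : (size (U 0%R j) <= size (B 1 0 * U 0 j)%R)%N.
    have [->|u0] := eqVneq (U 0 j) 0; first by rewrite size_poly0.
    by rewrite size_mul_pred // (polySpred u0) ltnS leq_addl.
  by case: (ord2P i) => ->; lia.
have : (mxdeg U <= 2 * delta)%N.
  apply/bigmax_leqP => i _; apply/bigmax_leqP => j _.
  by have := sizeU i j; case: (size (U i j)).
apply: leq_trans; rewrite /conj_deg; case: ex_minnP => m _; apply.
by apply/asboolP; exists U.
Qed.
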